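(* Let $n\ge 2$, $1\le t\le n-1$, $N=2^n-1$, $T=2^t-1$, $M=2^{n-t}-1$. Let $C$ be the binary code of length $N$ with parity check matrix $H_{n,t}$ (columns ordered lexicographically), let $\mathcal{D}$ be the triple system on $V=\{1,\dots,N\}$ whose blocks are the supports of all weight-$3$ codewords of $C$, let $V_0\subseteq V$ be the set of indices of the zero columns of $H_{n,t}$, and let $G_1,\dots,G_M$ be the groups (the classes of indices of identical nonzero columns). Then the block set of $\mathcal{D}$ splits as follows: (1) the blocks contained in $V_0$ form the complete $2$-$(T,3,T-2)$ design on $V_0$ (i.e. they are all $3$-subsets of $V_0$); (2) the blocks disjoint from $V_0$ form a group divisible design with the $M$ groups $G_1,\dots,G_M$ of size $T+1$ each, in which two points of the same group lie in no common block and two points of different groups lie in exactly $T+1$ common blocks; (3) every other block contains two points of the same group and exactly one point of $V_0$, and any two points in the same group lie in exactly $T$ blocks of this type.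
   Context: $H_{n,t}$ is the $(n-t)\times(2^n-1)$ binary matrix obtained from the matrix $H_n$ (whose columns are all distinct nonzero vectors of $\mathrm{GF}(2)^n$) by deleting $t$ rows; its columns consist of every nonzero vector of $\mathrm{GF}(2)^{n-t}$ exactly $2^t=T+1$ times and the zero vector exactly $T$ times. $C=\{c\in\mathrm{GF}(2)^N:H_{n,t}c^T=0\}$. For a nonzero $u\in\mathrm{GF}(2)^{n-t}$, the corresponding group is the set of column indices whose column equals $u$; so $|V_0|=T$ and each group has size $T+1$. A group divisible design with groups $G_1,\dots,G_M$ is an incidence structure on the union of the groups in which any two points of the same group lie in $\lambda_1$ blocks and any two points of different groups lie in $\lambda_2$ blocks. *)

(* Defs.v *)
(* MathComp; points and indices are counted from 0. *)
From mathcomp Require Import all_boot all_order all_algebra.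

Set Implicit Arguments.
Unset Strict Implicit.
Unset Printing Implicit Defensive.

Import Order.TTheory GRing.Theory.

Local Open Scope ring_scope.

Definition hamming_check (n N : nat) (Hn : 'M['F_2]_(n, N)) : Prop :=
  injective (fun j => col j Hn) /\
  [set col j Hn | j : 'I_N] = [set u : 'cV['F_2]_n | u != 0].

(* A column read from top to bottom. [seqlexi] equips sequences with the
   lexicographic order, for 0 < 1 in 'F_2. *)
Definition column_word (m N : nat) (H : 'M['F_2]_(m, N)) (j : 'I_N) :
    seqlexi 'F_2 :=
  [seq H i j | i <- enum 'I_m].

Definition lexicographic_columns (m N : nat) (H : 'M['F_2]_(m, N)) : Prop :=
  {homo column_word H : j k / (j <= k)%N >-> (j <= k)%O}.

Definition code_of_check (m N : nat) (H : 'M['F_2]_(m, N)) :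
    {set 'rV['F_2]_N} :=
  [set c | H *m c^T == 0].

Definition supp (N : nat) (c : 'rV['F_2]_N) : {set 'I_N} :=
  [set j | c 0 j != 0].

Definition wt (N : nat) (c : 'rV['F_2]_N) : nat := #|supp c|.

Definition triple_blocks (N : nat) (C : {set 'rV['F_2]_N}) :
    {set {set 'I_N}} :=
  [set supp c | c in C & wt c == 3%N].

Definition zero_columns (m N : nat) (H : 'M['F_2]_(m, N)) : {set 'I_N} :=
  [set j | col j H == 0].

Definition column_group (m N : nat) (H : 'M['F_2]_(m, N))
    (u : 'cV['F_2]_m) : {set 'I_N} :=
  [set j | col j H == u].

Definition column_groups (m N : nat) (H : 'M['F_2]_(m, N)) :
    {set {set 'I_N}} :=
  [set column_group H u | u : 'cV['F_2]_m & u != 0].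

Definition blocks_through (P : finType) (BB : {set {set P}}) (x y : P) : nat :=
  #|[set B in BB | (x \in B) && (y \in B)]|.

(* No inequality between v and k is required: for v < k this is the design
   without blocks, and for v < 2 the value of lam is irrelevant. *)
Definition two_design (P : finType) (v k lam : nat)
    (X : {set P}) (BB : {set {set P}}) : Prop :=
  [/\ #|X| = v,
      forall B, B \in BB -> B \subset X /\ #|B| = k
    & forall x y, x \in X -> y \in X -> x != y ->
        blocks_through BB x y = lam].

(* The point set is [cover GG], the union of the groups. *)
Definition group_divisible_design (P : finType) (lam1 lam2 : nat)
    (GG BB : {set {set P}}) : Prop :=
  [/\ partition GG (cover GG),
      forall B, B \in BB -> B \subset cover GG,
      forall G x y, G \in GG -> x \in G -> y \in G -> x != y ->
        blocks_through BB x y = lam1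
    & forall G G' x y, G \in GG -> G' \in GG -> G != G' ->
        x \in G -> y \in G' -> blocks_through BB x y = lam2].

(* Main.v *)
(* The support [B] of a word of weight 3 is a block exactly when the three
   columns indexed by [B] add up to 0, i.e. when each of them is the sum of the
   other two. Hence the blocks through two points x, y correspond to the
   positions z of the column h_x + h_y, other than x and y, and everything
   reduces to counting positions: deleting t rows is a surjective linear map
   whose fibres have 2^t elements, and only the zero vector is missing among the
   columns of the Hamming matrix. *)
Require Import Defs.
From mathcomp Require Import all_boot all_order all_algebra.

Set Implicit Arguments.
Unset Strict Implicit.
Unset Printing Implicit Defensive.

Import Order.TTheory GRing.Theory.

Local Open Scope ring_scope.

Lemma F2_neq0 (a : 'F_2) : (a != 0) = (a == 1).
Proof. by case: a => [[|[|k]] lt_k2]. Qed.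

Lemma addmx_F2 (m n : nat) (A : 'M['F_2]_(m, n)) : A + A = 0.
Proof. by apply/matrixP=> i j; rewrite !mxE addrr_pchar2 // pchar_Fp. Qed.

Lemma addmx_F2_eq0 (m n : nat) (A B : 'M['F_2]_(m, n)) :
  (A + B == 0) = (A == B).
Proof.
by rewrite addr_eq0; congr (_ == _); apply/eqP; rewrite eq_sym -addr_eq0 addmx_F2.
Qed.

(** The preimage carries entry [k] of [u] at position [f k], which is unambiguous because [f] is
    injective, and the default 0 at positions outside the image of [f]. *)
Lemma rowsub_surj (n m : nat) (f : 'I_m -> 'I_n) (u : 'cV['F_2]_m) :
  injective f -> exists v, rowsub f v = u.
Proof.
move=> inj_f.
exists (\col_i if [pick k | f k == i] is Some k then u k 0 else 0).
apply/colP=> k; rewrite !mxE; case: pickP => [l /eqP/inj_f -> //|/(_ k)].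
by rewrite eqxx.
Qed.

(** Each fibre is a translate of the kernel [F 0], so the [2 ^ n] vectors split into [2 ^ (n - t)]
    classes of equal size. *)
Lemma card_rowsub_fibre (n t : nat) (f : 'I_(n - t) -> 'I_n)
    (u : 'cV['F_2]_(n - t)) :
  (t <= n)%N -> injective f ->
  #|[set v : 'cV['F_2]_n | rowsub f v == u]| = (2 ^ t)%N.
Proof.
move=> le_tn inj_f; pose F w := [set v : 'cV['F_2]_n | rowsub f v == w].
have cardF w : #|F w| = #|F 0|.
  have [v0 v0w] := rowsub_surj w inj_f.
  rewrite -(card_imset (mem (F 0)) (addrI v0)); apply: eq_card => v.
  rewrite inE; apply/eqP/imsetP => [vw | [v1]].
    exists (v - v0); last by rewrite addrC subrK.
    by rewrite inE raddfB /= vw v0w subrr.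
  by rewrite inE => /eqP v1_0 ->; rewrite raddfD /= v0w v1_0 addr0.
have cardT: (2 ^ n = 2 ^ (n - t) * #|F 0%R|)%N.
  have <- : #|{: 'cV['F_2]_n}| = (2 ^ n)%N by rewrite card_mx card_Fp // muln1.
  have <- : #|{: 'cV['F_2]_(n - t)}| = (2 ^ (n - t))%N.
    by rewrite card_mx card_Fp // muln1.
  rewrite -[LHS]sum1_card (partition_big (rowsub f) xpredT) //= -sum_nat_const.
  apply: eq_big => // w _; rewrite -(cardF w) -sum1_card.
  by apply: eq_bigl => v; rewrite !inE.
rewrite -/(F u) cardF; apply/eqP.
by rewrite -(eqn_pmul2l (expn_gt0 2 (n - t))) -cardT -expnD subnK.
Qed.

(** Columns of [Hn] correspond bijectively to nonzero vectors, so the indices counted are those of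
    the fibre over [u] with the zero vector removed. That vector lies in the fibre only for [u = 0],
    whence the correction by the boolean [u == 0], read as 0 or 1. *)
Lemma card_hamming_columns (n t N : nat) (Hn : 'M['F_2]_(n, N))
    (f : 'I_(n - t) -> 'I_n) (u : 'cV['F_2]_(n - t)) :
  (t <= n)%N -> injective f -> hamming_check Hn ->
  #|column_group (rowsub f Hn) u| = (2 ^ t - (u == 0)%R)%N.
Proof.
move=> le_tn inj_f [inj_col im_col].
rewrite -(card_rowsub_fibre u le_tn inj_f) (cardsD1 0).
rewrite inE raddf0 eq_sym addnC addnK -(card_imset _ inj_col).
apply: eq_card => v; rewrite !inE; apply/imsetP/andP => [[j]|[v_neq0 /eqP vu]].
  have: col j Hn \in [set w : 'cV_n | w != 0] by rewrite -im_col; apply: imset_f.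
  rewrite !inE => colj_neq0 /eqP ju ->; split=> //.
  by rewrite -ju; apply/eqP/colP=> i; rewrite !mxE.
have: v \in [set col j Hn | j : 'I_N] by rewrite im_col inE.
case/imsetP=> j _ vj; exists j => //; rewrite inE -vu vj.
by apply/eqP/colP=> i; rewrite !mxE.
Qed.

(** A nonzero coefficient in ['F_2] is 1, so the syndrome of a word is the sum of the columns over
    its support. Conversely, [B] is the support of its indicator vector. *)
Lemma mem_triple_blocks (m N : nat) (H : 'M['F_2]_(m, N)) (B : {set 'I_N}) :
  (B \in triple_blocks (code_of_check H)) =
  (#|B| == 3%N) && (\sum_(j in B) col j H == 0).
Proof.
have synd c : H *m c^T = \sum_(j in supp c) col j H.
  apply/colP=> i; rewrite summxE mxE (bigID (mem (supp c))) /=.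
  rewrite [X in _ + X]big1 => [|j]; last first.
    by rewrite inE negbK mxE => /eqP ->; rewrite mulr0.
  rewrite addr0; apply: eq_bigr => j; rewrite inE F2_neq0 => /eqP cj.
  by rewrite !mxE cj mulr1.
apply/imsetP/andP => [[c] | [B3 sumB]].
  by rewrite !inE synd => /andP[sum0 c3] ->.
have suppB: B = supp (\row_j (j \in B)%:R).
  by apply/setP=> j; rewrite inE mxE; case: (j \in B).
by exists (\row_j (j \in B)%:R) => //; rewrite !inE synd /wt -suppB sumB.
Qed.

Lemma cards3 (T : finType) (x y z : T) :
  x != y -> z != x -> z != y -> #|[set x; y; z]| = 3%N.
Proof.
move=> xy zx zy.
by rewrite setUC cardsU1 cards2 !inE negb_or zx zy xy.
Qed.

Lemma cards3_pair (T : finType) (B : {set T}) (x y : T) :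
  #|B| = 3%N -> x \in B -> y \in B -> x != y ->
  exists z, [/\ z != x, z != y & B = [set x; y; z]].
Proof.
move=> B3 xB yB xy.
have sub: [set x; y] \subset B by rewrite subUset !sub1set xB.
have /cards1P[z Dz]: #|B :\: [set x; y]| == 1%N.
  by rewrite cardsDS // B3 cards2 xy.
have: z \in B :\: [set x; y] by rewrite Dz set11.
rewrite !inE negb_or -andbA => /and3P[zx zy zB].
by exists z; split=> //; rewrite -(setID B [set x; y]) Dz (setIidPr sub).
Qed.

(** A triple through [x] and [y] is determined by its third point, so counting blocks becomes
    counting points. *)
Lemma blocks_through_triples (T : finType) (BB : {set {set T}}) (x y : T) :
  (forall B, B \in BB -> #|B| = 3%N) -> x != y ->
  blocks_through BB x y =
  #|[set z | [&& z != x, z != y & [set x; y; z] \in BB]]|.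
Proof.
move=> BB3 xy; rewrite /blocks_through -[RHS](@card_in_imset _ _
  (fun z => [set x; y; z])) => [|z w]; last first.
  rewrite !inE => /and3P[zx zy _] _ /setP/(_ z).
  by rewrite !inE eqxx orbT (negPf zx) (negPf zy) => /esym/eqP.
apply: eq_card => B; rewrite !inE; apply/and3P/imsetP => [[BBB xB yB] | [z]].
  have [z [zx zy DB]] := cards3_pair (BB3 B BBB) xB yB xy.
  by exists z => //; rewrite inE zx zy -DB.
by rewrite inE => /and3P[zx zy zBB] ->; rewrite !inE !eqxx orbT.
Qed.

Lemma mem_triple_blocks3 (m N : nat) (H : 'M['F_2]_(m, N)) (x y z : 'I_N) :
  x != y -> z != x -> z != y ->
  ([set x; y; z] \in triple_blocks (code_of_check H)) =
  (col z H == col x H + col y H).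
Proof.
move=> xy zx zy; rewrite mem_triple_blocks cards3 //= setUC.
rewrite big_setU1 ?inE ?negb_or ?zx //= big_setU1 ?inE //= big_set1.
by rewrite addmx_F2_eq0.
Qed.

Lemma card_triple_block (m N : nat) (H : 'M['F_2]_(m, N)) (B : {set 'I_N}) :
  B \in triple_blocks (code_of_check H) -> #|B| = 3%N.
Proof. by rewrite mem_triple_blocks => /andP[/eqP]. Qed.

Lemma subset3 (T : finType) (A : {set T}) (x y z : T) :
  ([set x; y; z] \subset A) = [&& x \in A, y \in A & z \in A].
Proof. by rewrite !subUset !sub1set andbA. Qed.

Lemma in_column_group (m N : nat) (H : 'M['F_2]_(m, N)) (u : 'cV['F_2]_m)
    (x : 'I_N) :
  (x \in column_group H u) = (col x H == u).
Proof. by rewrite inE. Qed.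

Lemma mem_column_groups (m N : nat) (H : 'M['F_2]_(m, N)) (G : {set 'I_N})
    (x : 'I_N) :
  G \in column_groups H -> x \in G ->
  col x H != 0 /\ G = column_group H (col x H).
Proof.
by case/imsetP=> u; rewrite inE => u0 ->; rewrite inE => /eqP ->.
Qed.

Lemma cover_column_groups (m N : nat) (H : 'M['F_2]_(m, N)) :
  cover (column_groups H) = ~: zero_columns H.
Proof.
apply/setP=> x; rewrite !inE; apply/bigcupP/idP => [[G GG xG] | x0].
  by have [] := mem_column_groups GG xG.
by exists (column_group H (col x H)); rewrite ?inE // imset_f ?inE.
Qed.

(** Groups are disjoint because a point determines its column and hence its group. Nonemptiness is
    left as a hypothesis, to be supplied by the column count. *)
Lemma partition_column_groups (m N : nat) (H : 'M['F_2]_(m, N)) :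
  set0 \notin column_groups H ->
  partition (column_groups H) (cover (column_groups H)).
Proof.
move=> GG0; rewrite /partition eqxx GG0 andbT /=.
apply/trivIsetP=> G G' GG GG' neqG; apply/pred0Pn=> -[x /andP[/= xG xG']].
have [_ DG] := mem_column_groups GG xG; have [_ DG'] := mem_column_groups GG' xG'.
by rewrite DG DG' eqxx in neqG.
Qed.

(* [f] enumerates, in order, the n - t rows of [Hn] that are kept. *)
Theorem theorem2p7 (n t : nat) (hn : (2 <= n)%N) (ht : (1 <= t <= n - 1)%N)
    (Hn : 'M['F_2]_(n, 2 ^ n - 1)) (f : 'I_(n - t) -> 'I_n)
    (hHn : hamming_check Hn)
    (hf : {homo f : i j / (i < j)%N})
    (hlex : lexicographic_columns (rowsub f Hn)) :
  let T := (2 ^ t - 1)%N in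
  let M := (2 ^ (n - t) - 1)%N in
  let H := rowsub f Hn in
  let D := triple_blocks (code_of_check H) in
  let V0 := zero_columns H in
  let GG := column_groups H in
  let D1 := [set B in D | B \subset V0] in
  let D2 := [set B in D | [disjoint B & V0]] in
  let D3 := D :\: (D1 :|: D2) in
  [/\ [disjoint D1 & D2],
      two_design T 3 (T - 2) V0 D1 /\
      D1 = [set B : {set 'I_(2 ^ n - 1)} | B \subset V0 & #|B| == 3%N],
      [/\ #|GG| = M, forall G, G \in GG -> #|G| = T.+1
        & group_divisible_design 0 T.+1 GG D2]
    & (forall B, B \in D3 ->
         (exists2 G, G \in GG & #|B :&: G| = 2%N) /\ #|B :&: V0| = 1%N) /\
      (forall G x y, G \in GG -> x \in G -> y \in G -> x != y ->
         blocks_through D3 x y = T)].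
Proof.
move=> T M H D V0 GG D1 D2 D3.
have T_gt0: (0 < 2 ^ t)%N by rewrite expn_gt0.
have TS: T.+1 = (2 ^ t)%N by rewrite /T subn1 prednK.
have le_tn: (t <= n)%N by case/andP: ht => _ /leq_trans-> //; apply: leq_subr.
have inj_f: injective f.
  move=> i j eq_f; apply: ord_inj.
  by have [/hf | /hf |] := ltngtP i j; rewrite // eq_f ltnn.
have cardG u : u != 0 -> #|column_group H u| = T.+1.
  by move=> u0; rewrite card_hamming_columns // (negPf u0) subn0 TS.
have cardV0: #|V0| = T.
  by rewrite /T -[V0]/(column_group H 0) card_hamming_columns // eqxx.
have D_3 B : B \in D -> #|B| = 3%N by apply: card_triple_block.
have D1_3 B : B \in D1 -> #|B| = 3%N by rewrite inE => /andP[/D_3].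
have D2_3 B : B \in D2 -> #|B| = 3%N by rewrite inE => /andP[/D_3].
have D3_3 B : B \in D3 -> #|B| = 3%N by rewrite inE => /andP[_ /D_3].
(* Inside [V0] the parity condition is vacuous: zero columns always add up to 0. *)
have D1E: D1 = [set B : {set 'I_(2 ^ n - 1)} | B \subset V0 & #|B| == 3%N].
  apply/setP=> B; rewrite !inE mem_triple_blocks andbC.
  case: (boolP (B \subset V0)) => //= /subsetP BV0; rewrite big1 ?eqxx ?andbT //.
  by move=> j /BV0; rewrite inE => /eqP.
have GG_card G : G \in GG -> #|G| = T.+1.
  by case/imsetP=> u; rewrite inE => /cardG u1 ->.
have GG0: set0 \notin GG by apply/negP=> /GG_card; rewrite cards0.
split.
- rewrite -setI_eq0; apply/set0Pn=> -[B]; rewrite !inE.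
  case/andP=> /andP[BD BV0] /andP[_]; rewrite -setI_eq0 (setIidPl BV0) => /eqP B0.
  by move: (D_3 B BD); rewrite B0 cards0.
- split=> //; split=> // [B | x y xV0 yV0 xy].
    by rewrite D1E inE => /andP[-> /eqP].
  rewrite blocks_through_triples //.
  have ->: [set z | [&& z != x, z != y & [set x; y; z] \in D1]] =
           V0 :\: [set x; y].
    apply/setP=> z; rewrite D1E !inE subset3 xV0 yV0 negb_or -andbA /= inE.
    case: eqVneq => //= zx; case: eqVneq => //= zy.
    by rewrite cards3 // eqxx andbT.
  by rewrite cardsDS ?subUset ?sub1set ?xV0 // cardV0 cards2 xy.
- split=> //.
    (* Distinct nonzero vectors give distinct groups, because each group has a member whose column
       recovers the vector. *)
    rewrite card_in_imset => [|u v].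
      rewrite [LHS](_ : _ = #|[set~ (0 : 'cV['F_2]_(n - t))]|).
        by rewrite cardsC1 card_mx card_Fp // muln1 /M subn1.
      by apply: eq_card => u; rewrite !inE.
    rewrite !inE => u0 v0 /setP eq_uv.
    have /card_gt0P[j ju]: (0 < #|column_group H u|)%N by rewrite cardG.
    by have := ju; rewrite eq_uv; move: ju; rewrite !inE => /eqP-> /eqP.
  split=> [|B|G x y GGG xG yG xy|G G' x y GGG GGG' neqG xG yG'].
  + exact: partition_column_groups.
  + by rewrite cover_column_groups inE -disjoints_subset => /andP[].
  (* Equal columns cancel, so a third point would have column 0 and the block would meet [V0]. *)
  + rewrite blocks_through_triples // eq_card0 // => z.
    have [x0 DG] := mem_column_groups GGG xG.
    move: yG; rewrite DG in_column_group => /eqP yx.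
    rewrite !inE; apply/and3P=> -[zx zy].
    rewrite mem_triple_blocks3 // yx addmx_F2 disjoints_subset subset3 !inE.
    by case/andP=> -> /and3P[].
  + have [x0 DG] := mem_column_groups GGG xG.
    have [y0 DG'] := mem_column_groups GGG' yG'.
    (* The third points fill the whole group of this nonzero sum. Neither [x] nor [y] lies in it,
       since that would make the other column zero, so the count stays [T.+1]. *)
    have xy0: col x H + col y H != 0.
      by rewrite addmx_F2_eq0; apply: contraNneq neqG => e; rewrite DG DG' e.
    have xy: x != y by apply: contraNneq xy0 => ->; rewrite addmx_F2.
    rewrite blocks_through_triples // -(cardG _ xy0); apply: eq_card => z.
    rewrite !inE; case: (eqVneq z x) => [->|zx] /=.
      by rewrite -[X in X == _]addr0 (inj_eq (addrI _)) eq_sym (negPf y0).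
    case: (eqVneq z y) => [->|zy] /=.
      by rewrite -[X in X == _]add0r (inj_eq (addIr _)) eq_sym (negPf x0).
    rewrite mem_triple_blocks3 // disjoints_subset subset3 !inE x0 y0 /=.
    by case: eqP => // ->.
- split=> [B|G x y GGG xG yG xy].
    rewrite !inE => /andP[+ BD]; rewrite BD /= negb_or => /andP[BnV0].
    rewrite -setI_eq0 => /set0Pn[z]; rewrite inE => /andP[zB zV0].
    have [x xB xV0] := subsetPn BnV0.
    have zx: z != x by apply: contraNneq xV0 => <-.
    have [y [yz yx DB]] := cards3_pair (D_3 B BD) zB xB zx.
    (* With [z] in [V0] and [x] outside it, the vanishing column sum puts the remaining point [y] in
       the group of [x]. *)
    have yxc: col y H = col x H.
      move: BD zV0; rewrite DB mem_triple_blocks3 // inE => /eqP -> /eqP ->.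
      by rewrite add0r.
    move: xV0 zV0; rewrite !inE => x0 /eqP z0.
    split; last first.
      apply/eqP/cards1P; exists z; apply/setP=> w; rewrite DB !inE.
      case: (eqVneq w z) => [->|wz]; first by rewrite z0 eqxx.
      case: (eqVneq w x) => [->|wx]; first by rewrite (negPf x0).
      by case: (eqVneq w y) => [->|wy] //; rewrite yxc (negPf x0).
    exists (column_group H (col x H)); first by rewrite imset_f ?inE.
    rewrite [B :&: _](_ : _ = [set x; y]) ?cards2 1?eq_sym ?yx //.
    apply/setP=> w; rewrite DB !inE.
    case: (eqVneq w x) => [->|wx]; first by rewrite eqxx orbT.
    case: (eqVneq w y) => [->|wy]; first by rewrite yxc eqxx orbT.
    by case: (eqVneq w z) => [->|wz] //; rewrite z0 eq_sym (negPf x0).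
  have [x0 DG] := mem_column_groups GGG xG.
  move: yG; rewrite DG in_column_group => /eqP yx.
  (* Here the third column must be 0, so the third points are exactly those of [V0]. Each such
     triple meets [V0] without being contained in it, hence belongs to [D3]. *)
  rewrite blocks_through_triples // -cardV0; apply: eq_card => z.
  rewrite !inE; case: (eqVneq z x) => [->|zx] /=; first by rewrite (negPf x0).
  case: (eqVneq z y) => [->|zy] /=; first by rewrite yx (negPf x0).
  rewrite disjoints_subset !subset3 !inE yx (negPf x0) /=.
  by rewrite mem_triple_blocks3 // yx addmx_F2; case: eqP.
Qed.
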